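(* Let $S$ be a Stone semiring. Then $(\operatorname{Skel}(S), \vee, \wedge)$ is a bounded complemented lattice, where $s \vee t = (s^* t^* )^*$ and $s \wedge t = s t$ for $s,t\in\operatorname{Skel}(S)$.
   Context: A semiring is a set $S$ with operations $+,\cdot$ such that $(S,+)$ is a commutative monoid with identity $0$, $(S,\cdot)$ is a commutative monoid with identity $1\neq 0$, multiplication distributes over addition, and $s\cdot 0=0$ for all $s\in S$. An ordered semiring is a semiring with a partial order $\leq$ such that $s\leq t$ implies $s+u\leq t+u$ for all $u$, and $s\leq t$, $0\leq u$ imply $su\leq tu$. It is positive if $0\leq s$ for all $s\in S$. In an ordered semiring $S$, an element $s$ is pseudocomplemented if there is an element $s^*\in S$ (necessarily unique, called the pseudocomplement of $s$) such that $ss^*=0$ and, for each $x\in S$, $sx=0$ implies $x\leq s^*$. $\operatorname{pcomp}(S)$ is the set of pseudocomplemented elements of $S$, and $\operatorname{Skel}(S)=\{s^*: s\in \operatorname{pcomp}(S)\}$. Write $s^{**}=(s^* )^*$ when it exists. For $S$ positive, $s\in S$ is a Stone element if $s,s^*\in\operatorname{pcomp}(S)$ and $s^*+s^{**}=1$. A Stone semiring is a positive semiring all of whose elements are Stone elements (in particular every element is pseudocomplemented). *)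

(* Defs.v *)
From Corelib Require Relation_Definitions.
From mathcomp Require Import all_boot all_order all_algebra.
From mathcomp Require Import boolp classical_sets.

Set Implicit Arguments.
Unset Strict Implicit.
Unset Printing Implicit Defensive.

Import Order.TTheory GRing.Theory.
Local Open Scope classical_set_scope.
Local Open Scope ring_scope.

(* The order cannot be taken from porderType: MathComp's only join of an order
   and an addition on a common carrier is porderZmodType, which has opposites. *)
Record ordered_semiring : Type := OrderedSemiring {
  os_sort :> comNzSemiRingType;
  os_le : os_sort -> os_sort -> Prop;
  os_order : Relation_Definitions.order os_sort os_le;
  os_leD2r : forall s t u : os_sort, os_le s t -> os_le (s + u) (t + u);
  os_leM2r : forall s t u : os_sort,
    os_le s t -> os_le 0 u -> os_le (s * u) (t * u)
}.

Section Pseudocomplement.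
Variable S : ordered_semiring.

Definition positive_semiring : Prop := forall s : S, os_le 0 s.

Definition is_pseudocomplement (s t : S) : Prop :=
  s * t = 0 /\ forall x : S, s * x = 0 -> os_le x t.

Definition pcomp : set S := [set s | exists t, is_pseudocomplement s t].

(* The value is meaningful only for s in pcomp, where the pseudocomplement
   exists and is unique by antisymmetry; it is 0 otherwise. *)
Definition pseudocompl (s : S) : S := xget 0 (is_pseudocomplement s).

Definition Skel : set S := [set pseudocompl s | s in pcomp].

Definition stone_element (s : S) : Prop :=
  [/\ pcomp s, pcomp (pseudocompl s)
    & pseudocompl s + pseudocompl (pseudocompl s) = 1].

Definition stone_semiring : Prop :=
  positive_semiring /\ forall s : S, stone_element s.

Definition skel_join (s t : S) : S :=
  pseudocompl (pseudocompl s * pseudocompl t).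

Definition skel_meet (s t : S) : S := s * t.

End Pseudocomplement.

Arguments positive_semiring S : clear implicits.
Arguments pcomp S : clear implicits.
Arguments Skel S : clear implicits.
Arguments stone_semiring S : clear implicits.

Definition complemented_lattice d (L : tbLatticeType d) : Prop :=
  forall x : L, exists y : L,
    Order.join x y = Order.top /\ Order.meet x y = Order.bottom.

(* (A, join, meet) is a bounded complemented lattice: the set A, seen as a
   type, carries a tbLatticeType structure c whose operations are the
   restrictions of join and meet (so A is closed under both). The order of c
   is not constrained separately, since it is determined by its meet. *)
Definition bounded_complemented_lattice (T : choiceType) (A : set T)
    (join meet : T -> T -> T) : Prop :=
  exists (d : Order.disp_t) (c : Order.TBLattice.axioms_ d A),
    let L : tbLatticeType d := Order.TBLattice.Pack c in
    [/\ forall x y : L, val (Order.join x y : A)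
                        = join (val (x : A)) (val (y : A)),
        forall x y : L, val (Order.meet x y : A)
                        = meet (val (x : A)) (val (y : A))
      & complemented_lattice L].

(* Main.v *)
(* In a Stone semiring 1 is the greatest element, so s + t = 1 and s t = 0 force
   t = s^*. The skeleton therefore consists of the complemented elements, which
   are idempotent; on it (s t)^* = s^* + s t^*, hence s \vee t = s + s^* t, and
   every lattice law becomes an identity of the semiring. *)
From HB Require Import structures.
Require Import Defs.
From mathcomp Require Import all_boot all_order all_algebra.
From mathcomp Require Import boolp classical_sets.

Import GRing.Theory.
Local Open Scope ring_scope.

Section StoneSemiring.
Context {S : ordered_semiring}.
Implicit Types s t u x y : S.

Lemma os_le_anti s t : os_le s t -> os_le t s -> s = t.
Proof. by case: (os_order S) => _ _; apply. Qed.

Lemma is_pseudocomplement_uniq s t u :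
  is_pseudocomplement s t -> is_pseudocomplement s u -> t = u.
Proof. by move=> [st0 tP] [su0 uP]; apply: os_le_anti; [apply: uP | apply: tP]. Qed.

Lemma pseudocomplE s t : is_pseudocomplement s t -> pseudocompl s = t.
Proof.
move=> st; apply: (is_pseudocomplement_uniq s) => //.
(* The default 0 of [xget] does not arise, since [t] witnesses existence. *)
by apply: xgetPex; exists t.
Qed.

Hypothesis hS : stone_semiring S.

Lemma pseudocomplP s : is_pseudocomplement s (pseudocompl s).
Proof. by have [[t st] _ _] := hS.2 s; rewrite (pseudocomplE s t). Qed.

Lemma mul_pseudocompl s : s * pseudocompl s = 0.
Proof. by case: (pseudocomplP s). Qed.

Lemma pseudocompl_add s : pseudocompl s + pseudocompl (pseudocompl s) = 1.
Proof. by have [] := hS.2 s. Qed.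

(* The pseudocomplement of 0 is the greatest element, and it is at most
   pseudocompl 0 + pseudocompl (pseudocompl 0) = 1. *)
Lemma stone_le1 s : os_le s 1.
Proof.
have top0 t : os_le t (pseudocompl 0).
  by case: (pseudocomplP 0) => _; apply; rewrite mul0r.
suff <- : pseudocompl 0 = 1 :> S by [].
apply: os_le_anti => //; rewrite -[X in os_le _ X](pseudocompl_add 0).
have := os_leD2r (pseudocompl 0) (hS.1 (pseudocompl (pseudocompl 0))).
by rewrite add0r addrC.
Qed.

(** If $s x = 0$ then $x = x (s + t) = x t \leq 1 \cdot t$, because 1 is the greatest element and $t
    \geq 0$. *)
Lemma pseudocompl_complement s t : s + t = 1 -> s * t = 0 -> pseudocompl s = t.
Proof.
move=> st1 st0; apply: pseudocomplE; split=> // x sx0.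
have -> : x = x * t by rewrite -[LHS]mulr1 -st1 mulrDr [x * s]mulrC sx0 add0r.
by have := os_leM2r (stone_le1 x) (hS.1 t); rewrite mul1r.
Qed.

(** Being complements is symmetric, so $t^* = s$. Together with [Skel_add_pseudocompl], this
    identifies the skeleton with the complemented elements. *)
Lemma Skel_complement s t : s + t = 1 -> s * t = 0 -> Skel S s.
Proof.
move=> st1 st0; exists t; first by exists (pseudocompl t); apply: pseudocomplP.
by apply: pseudocompl_complement; rewrite 1?addrC 1?mulrC.
Qed.

Lemma Skel_add_pseudocompl s : Skel S s -> s + pseudocompl s = 1.
Proof. by case=> t _ <-; apply: pseudocompl_add. Qed.

Lemma Skel_pseudocompl s : Skel S (pseudocompl s).
Proof. by exists s => //; exists (pseudocompl s); apply: pseudocomplP. Qed.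

Lemma Skel_idem s : Skel S s -> s * s = s.
Proof.
move=> /Skel_add_pseudocompl s1.
by rewrite -[RHS]mulr1 -s1 mulrDr mul_pseudocompl addr0.
Qed.

Lemma Skel0 : Skel S 0.
Proof. by apply: (Skel_complement 0 1); rewrite ?add0r ?mul0r. Qed.

Lemma Skel1 : Skel S 1.
Proof. by apply: (Skel_complement 1 0); rewrite ?addr0 ?mulr0. Qed.

(** Both conclusions come from one complement of $st$: $st + s t^* = s$ and $s + s^* = 1$ give the
    sum, while $s s^* = t t^* = 0$ give the product. *)
Lemma pseudocompl_meet s t : Skel S s -> Skel S t ->
  pseudocompl (s * t) = pseudocompl s + s * pseudocompl t /\ Skel S (s * t).
Proof.
move=> Ss St; set r := pseudocompl s + _.
have r1 : s * t + r = 1.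
  by rewrite addrCA -mulrDr Skel_add_pseudocompl// mulr1 addrC Skel_add_pseudocompl.
have r0 : s * t * r = 0.
  rewrite mulrDr mulrAC mul_pseudocompl mul0r add0r.
  by rewrite mulrACA mul_pseudocompl mulr0.
by split; [apply: pseudocompl_complement | apply: Skel_complement r1 r0].
Qed.

Lemma Skel_pseudocomplK s : Skel S s -> pseudocompl (pseudocompl s) = s.
Proof.
move=> Ss; apply: pseudocompl_complement.
  by rewrite addrC Skel_add_pseudocompl.
by rewrite mulrC mul_pseudocompl.
Qed.

(** Apply [pseudocompl_meet] to $s^*$ and $t^*$, then cancel the double stars. *)
Lemma skel_joinE s t : Skel S s -> Skel S t ->
  skel_join s t = s + pseudocompl s * t.
Proof.
move=> Ss St; rewrite /skel_join (pseudocompl_meet _ _ _ _).1 ?Skel_pseudocomplK//;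
exact: Skel_pseudocompl.
Qed.

Lemma Skel_meet s t : Skel S s -> Skel S t -> Skel S (skel_meet s t).
Proof. by move=> Ss St; have [] := pseudocompl_meet s t Ss St. Qed.

Lemma Skel_join s t : Skel S (skel_join s t).
Proof. exact: Skel_pseudocompl. Qed.

Lemma skel_joinC s t : skel_join s t = skel_join t s.
Proof. by rewrite /skel_join mulrC. Qed.

Lemma skel_joinA s t u : Skel S s -> Skel S t -> Skel S u ->
  skel_join s (skel_join t u) = skel_join (skel_join s t) u.
Proof.
move=> Ss St Su; rewrite /skel_join.
have K x y : pseudocompl (pseudocompl (pseudocompl x * pseudocompl y))
    = pseudocompl x * pseudocompl y.
  by rewrite Skel_pseudocomplK//; apply: Skel_meet; exact: Skel_pseudocompl.
by rewrite !K mulrA.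
Qed.

Lemma skel_meetKU s t : Skel S s -> Skel S t -> skel_join s (skel_meet s t) = s.
Proof.
move=> Ss St; rewrite skel_joinE//; last exact: Skel_meet.
by rewrite mulrCA mulrA mul_pseudocompl mul0r addr0.
Qed.

Lemma skel_joinKI s t : Skel S s -> Skel S t -> skel_meet s (skel_join s t) = s.
Proof.
move=> Ss St.
by rewrite skel_joinE// /skel_meet mulrDr Skel_idem// mulrA mul_pseudocompl
  mul0r addr0.
Qed.

Lemma skel_meetUr s t u : Skel S s -> Skel S t -> Skel S u ->
  skel_meet s (skel_join t u) = skel_join (skel_meet s t) (skel_meet s u).
Proof.
move=> Ss St Su; rewrite !skel_joinE//; [|exact: Skel_meet..].
rewrite /skel_meet (pseudocompl_meet _ _ _ _).1// mulrDr mulrDl.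
rewrite [pseudocompl s * _]mulrA [pseudocompl s * s]mulrC mul_pseudocompl.
by rewrite mul0r add0r [s * pseudocompl t * _]mulrACA Skel_idem.
Qed.

Definition skel_elt s (Ss : Skel S s) : Skel S := exist _ s (mem_set Ss).

Lemma skel_val (x : Skel S) : Skel S (val x).
Proof. exact: set_mem (valP x). Qed.

End StoneSemiring.

Theorem theorem2p16 (S : ordered_semiring) (hS : stone_semiring S) :
  bounded_complemented_lattice (Skel S) (@skel_join S) (@skel_meet S).
Proof.
pose meet (x y : Skel S) := skel_elt _ (Skel_meet hS _ _ (skel_val x) (skel_val y)).
pose join (x y : Skel S) := skel_elt _ (Skel_join hS (val x) (val y)).
(* The order is read off from the meet, so the order axioms of the mixin hold by [erefl]. *)
pose le (x y : Skel S) := meet x y == x.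
pose lt (x y : Skel S) := (y != x) && le x y.
have meetC : commutative meet.
  by move=> x y; apply: val_inj; rewrite /= /skel_meet mulrC.
have joinC : commutative join.
  by move=> x y; apply: val_inj; rewrite /= skel_joinC.
have meetA : associative meet.
  by move=> x y z; apply: val_inj; rewrite /= /skel_meet mulrA.
have joinA : associative join.
  move=> x y z; apply: val_inj; apply: (skel_joinA hS); exact: skel_val.
have joinKI (y x : Skel S) : meet x (join x y) = x.
  apply: val_inj; apply: (skel_joinKI hS); exact: skel_val.
have meetKU (y x : Skel S) : join x (meet x y) = x.
  apply: val_inj; apply: (skel_meetKU hS); exact: skel_val.
have meetUl : left_distributive meet join.
  move=> x y z; rewrite !(meetC _ z); apply: val_inj.
  apply: (skel_meetUr hS); exact: skel_val.
have meetxx : idempotent_op meet.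
  move=> x; apply: val_inj; exact: (Skel_idem hS _ (skel_val x)).
pose lattice_mixin := Order.isMeetJoinDistrLattice.Build (Order.Disp tt tt) (Skel S)
  (fun _ _ => erefl (le _ _)) (fun _ _ => erefl (lt _ _))
  meetC joinC meetA joinA joinKI meetKU meetUl meetxx.
pose D : distrLatticeType _ := HB.pack {x : S | x \in Skel S} lattice_mixin.
have le0x (x : D) : (skel_elt 0 (Skel0 hS) <= x :> D)%O.
  by apply/eqP/val_inj; rewrite /= /skel_meet mul0r.
have lex1 (x : D) : (x <= skel_elt 1 (Skel1 hS) :> D)%O.
  by apply/eqP/val_inj; rewrite /= /skel_meet mulr1.
pose L : tbLatticeType _ := HB.pack (Order.DistrLattice.sort D)
  (Order.hasBottom.Build _ D le0x) (Order.hasTop.Build _ D lex1).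
exists _, (Order.TBLattice.class L); split=> // x.
have Sx := skel_val (x : Skel S).
(* The lattice complement of $x$ is $x^*$: the join is $x + x^* x^* = x + x^* = 1$ by idempotence,
   and the meet is $x x^* = 0$. *)
exists (skel_elt _ (Skel_pseudocompl hS (val (x : Skel S)))).
split; apply: val_inj => /=.
  rewrite skel_joinE//; last exact: Skel_pseudocompl.
  by rewrite Skel_idem//; [apply: Skel_add_pseudocompl | apply: Skel_pseudocompl].
exact: mul_pseudocompl.
Qed.
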